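(* The only graphs $G$ (of order $n$) with skew zero forcing polynomial $\mathcal{Z}^-(G;x)=\sum_{i=0}^n \binom{n}{i}x^i=(x+1)^n$ are the two-set perfectly orderable graphs; that is, $\mathcal{Z}^-(G;x)=(x+1)^n$ if and only if $G$ is two-set perfectly orderable.
   Context: Graphs are finite, simple (no loops or multiple edges), undirected; $n=|V(G)|$ is the order of $G$. Skew zero forcing: a subset $S\subseteq V(G)$ (possibly empty) is colored blue and all other vertices white. Skew color change rule: if any vertex (blue or white) has exactly one white neighbor, then that white neighbor becomes blue. $S$ is a skew zero forcing set if repeated application of the rule eventually turns all vertices blue. The skew zero forcing polynomial is $\mathcal{Z}^-(G;x)=\sum_{i=0}^n z^-(G;i)x^i$, where $z^-(G;i)$ is the number of skew zero forcing sets of $G$ of cardinality $i$. A graph $G$ is two-set perfectly orderable if (1) $V(G)$ can be partitioned into ordered sets $U=\{u_1,\ldots,u_m\}$ and $W=\{w_1,\ldots,w_m\}$ such that $u_i v\in E(G)$ only if $v=w_j$ for some $j\le i$, and (2) $u_iw_i\in E(G)$ for all $i\in\{1,\ldots,m\}$. *)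

(* Defs.v *)
(* MathComp. A finite simple graph is a finType [V] of vertices with an
   adjacency relation [e : rel V] that is symmetric and irreflexive. *)
From HB Require Import structures.
From mathcomp Require Import all_boot all_order all_algebra.

Set Implicit Arguments.
Unset Strict Implicit.
Unset Printing Implicit Defensive.

Import GRing.Theory.
Local Open Scope ring_scope.

Definition neighbors (V : finType) (e : rel V) (v : V) : {set V} :=
  [set w | e v w].

(* [B] and [B'] are the sets of blue vertices before and after a single force.
   The forcing vertex [v] need not be in [B]: this is the "skew" rule. *)
Definition skew_force (V : finType) (e : rel V) : rel {set V} :=
  fun B B' => [exists v, exists w,
    (neighbors e v :\: B == [set w]) && (B' == w |: B)].

Definition skew_zero_forcing_set (V : finType) (e : rel V) (S : {set V}) : bool :=
  connect (skew_force e) S [set: V].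

Definition skew_zero_forcing_count (V : finType) (e : rel V) (i : nat) : nat :=
  #|[set S : {set V} | skew_zero_forcing_set e S & #|S| == i]|.

Definition skew_zero_forcing_poly (V : finType) (e : rel V) : {poly int} :=
  \sum_(i < #|V|.+1) (skew_zero_forcing_count e i)%:R *: 'X^i.

(* An ordered set of m vertices is an injective map from 'I_m; indices start
   at 0. Nothing is required of edges between two vertices of W. *)
Definition two_set_perfectly_orderable (V : finType) (e : rel V) : Prop :=
  exists (m : nat) (u w : 'I_m -> V),
    [/\ injective u /\ injective w,
        [set u i | i : 'I_m] :&: [set w i | i : 'I_m] = set0
        /\ [set u i | i : 'I_m] :|: [set w i | i : 'I_m] = [set: V],
        forall (i : 'I_m) (v : V), e (u i) v ->
          exists j : 'I_m, (j <= i)%N /\ v = w j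
      & forall i : 'I_m, e (u i) (w i)].

(* Main.v *)
(* A vertex v performs at most one force, since afterwards all its neighbors
   are blue; so if the empty set is forcing, the map f sending each vertex to
   the vertex that forces it is a permutation.  With t the time of coloring,
   the neighbors of f w other than w are colored before w: a permuted adjacency
   matrix is triangular, so its transversal is unique.  As the matrix is
   symmetric, f is an involution, i.e. a perfect matching.  Taking for W the
   vertex of each matching edge that is colored first, ordered by t, gives the
   two-set perfect order.  Conversely, such an order forces W upwards and then
   U downwards, from any initial set. *)
Require Import Defs.
From HB Require Import structures.
From mathcomp Require Import all_boot all_order all_algebra.
Set Implicit Arguments.
Unset Strict Implicit.
Unset Printing Implicit Defensive.
Import GRing.Theory.
Local Open Scope ring_scope.

Lemma sum_bin_XD1 (R : comNzRingType) (n : nat) :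
  \sum_(i < n.+1) 'C(n, i)%:R *: 'X^i = ('X + 1) ^+ n :> {poly R}.
Proof.
rewrite addrC exprDn; apply: eq_bigr => i _.
by rewrite expr1n mul1r scaler_nat.
Qed.

Section SkewForcing.

Variables (V : finType) (e : rel V).

(** Inclusion replaces the rule's exact condition so that [w] may already be blue, in which case
    nothing is forced. The orders below can thus be run from any starting set. *)
Lemma connect_skew_force (B : {set V}) (v w : V) :
  e v w -> neighbors e v \subset w |: B -> connect (skew_force e) B (w |: B).
Proof.
move=> evw sub; have [wB|wB] := boolP (w \in B).
  by rewrite (setUidPr _) ?connect0 // sub1set.
apply/connect1/existsP; exists v; apply/existsP; exists w.
rewrite eqxx andbT; apply/eqP/setP=> x; rewrite !inE.
apply/andP/eqP => [[xB evx]|->]; last by [].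
have := subsetP sub x; rewrite !inE => /(_ evx).
by rewrite (negPf xB) orbF => /eqP.
Qed.

Lemma orderable_forcing (e_sym : symmetric e) (S : {set V}) :
  two_set_perfectly_orderable e -> skew_zero_forcing_set e S.
Proof.
case=> m [u [w [[_ w_inj] [_ UW] nbr_u euw]]].
have forceW k : (k <= m)%N ->
    connect (skew_force e) S (S :|: [set w j | j : 'I_m & (j < k)%N]).
  elim: k => [_|k IHk lt_km].
    rewrite (_ : _ :|: _ = S) ?connect0 //; apply/setUidPl/subsetP => x.
    by case/imsetP=> j; rewrite inE.
  apply: connect_trans (IHk (ltnW lt_km)) _.
  set B := S :|: _; pose i := Ordinal lt_km.
  have -> : S :|: [set w j | j : 'I_m & (j < k.+1)%N] = w i |: B.
    apply/setP=> x; rewrite /B !inE orbCA; congr (_ || _).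
    apply/imsetP/orP => [[j]|[/eqP->|/imsetP[j]]]; rewrite ?inE.
    - rewrite ltnS leq_eqVlt => /orP[/eqP jk ->|jk ->].
        by left; apply/eqP; congr w; apply: val_inj.
      by right; apply/imsetP; exists j; rewrite ?inE.
    - by exists i; rewrite ?inE //=.
    - by move=> jk ->; exists j; rewrite ?inE // ltnS ltnW.
  (* The forcer is [u i], possibly still white: its neighbors are [w j] with [j <= i], all blue
     except perhaps [w i]. *)
  apply: (connect_skew_force (euw i)); apply/subsetP=> x; rewrite !inE.
  case/nbr_u=> j [le_ji ->]; move: le_ji; rewrite leq_eqVlt.
  case/orP=> [/eqP/val_inj->|lt_ji]; first by rewrite eqxx.
  by apply/orP; right; apply/orP; right; apply/imsetP; exists j; rewrite ?inE.
pose SW := S :|: [set w j | j : 'I_m & (j < m)%N].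
have wSW j : w j \in SW by rewrite inE imset_f ?orbT // inE ltn_ord.
have forceU k : (k <= m)%N -> connect (skew_force e) SW
    (SW :|: [set u j | j : 'I_m & (m - k <= j)%N]).
  elim: k => [_|k IHk lt_km].
    rewrite (_ : _ :|: _ = SW) ?connect0 //; apply/setUidPl/subsetP => x.
    by case/imsetP=> j; rewrite inE subn0 leqNgt ltn_ord.
  apply: connect_trans (IHk (ltnW lt_km)) _.
  set B := SW :|: _.
  have lt_im : (m - k.+1 < m)%N by rewrite ltn_subrL (leq_trans _ lt_km).
  pose i := Ordinal lt_im.
  (* After [k] downward steps the [u j] with [j > i] are blue, so [u i] is next. *)
  have Si : (m - k = i.+1)%N by rewrite /= subnSK.
  have -> : SW :|: [set u j | j : 'I_m & (m - k.+1 <= j)%N] = u i |: B.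
    apply/setP=> x; rewrite /B Si !(inE, in_setU SW) orbCA; congr (_ || _).
    apply/imsetP/orP => [[j]|[/eqP->|/imsetP[j]]]; rewrite ?inE.
    - rewrite leq_eqVlt => /orP[/eqP ij ->|ij ->].
        by left; apply/eqP; congr u; apply: val_inj.
      by right; apply/imsetP; exists j; rewrite ?inE.
    - by exists i; rewrite ?inE /=.
    - by move=> ij ->; exists j; rewrite ?inE // ltnW.
  have ewu : e (w i) (u i) by rewrite e_sym.
  apply: (connect_skew_force ewu); apply/subsetP=> x.
  rewrite inE /B Si e_sym => exw.
  have: x \in [set: V] by [].
  (* Neighbors of [w i] inside W are blue already. For a neighbor [u j], the order condition read at
     [u j] gives [i <= j], so it is [u i] or blue. *)
  rewrite -UW => /setUP[] /imsetP[j _ xE]; last first.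
    by rewrite in_setU1 in_setU xE wSW orbT.
  move: exw; rewrite xE => /nbr_u[j' [le_j'j /w_inj ij']].
  move: le_j'j; rewrite -ij' leq_eqVlt.
  case/orP=> [/eqP/val_inj->|lt_ij]; first by rewrite !inE eqxx.
  apply/setUP; right; apply/setUP; right.
  by apply/imsetP; exists j; rewrite ?inE.
apply: connect_trans (forceW m (leqnn m)) _.
have := forceU m (leqnn m); congr (connect _ _ _).
apply/setP=> x; rewrite [RHS]in_setT.
have: x \in [set: V] by [].
rewrite -UW => /setUP[] /imsetP[j _ ->]; apply/setUP; [right|left].
  by apply/imsetP; exists j; rewrite // inE subnn.
exact: wSW.
Qed.

(** Induction on the last force. Here [f w] is the vertex that forces [w], and [t w] counts the
    vertices blue just before. The clause [x \in B] ensures that a later force, which extends [t]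
    and [f] to a new vertex, leaves the earlier conditions intact. *)
Lemma forcing_order (B : {set V}) :
  connect (skew_force e) set0 B ->
  exists (t : V -> nat) (f : V -> V),
    {in B &, injective t} /\
    {in B, forall w, [/\ (t w < #|B|)%N, e (f w) w &
      forall x, e (f w) x -> x \in B /\ (x = w \/ (t x < t w)%N)]}.
Proof.
case/connectP=> p; elim/last_ind: p B => [|p C IHp] B /=.
  move=> _ ->; exists (fun=> 0%N), id.
  by split=> w; rewrite inE.
rewrite rcons_path last_rcons => /andP[/IHp/(_ erefl)].
move: (last _ _) => A [t [f [t_inj tf]]] + ->.
case/existsP=> v /existsP[w /andP[/eqP NvA /eqP ->]].
have /setDP[/[!inE] evw wA] : w \in neighbors e v :\: A by rewrite NvA set11.
have nbrv x : e v x -> x = w \/ x \in A.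
  move=> evx; have [xA|xA] := boolP (x \in A); [by right|left].
  by apply/set1P; rewrite -NvA !inE xA.
have neqA x : x \in A -> (x == w) = false.
  by move=> xA; apply: contraNF wA => /eqP <-.
(* The time [#|A|] exceeds all earlier ones, by the bound kept in the induction. *)
exists (fun x => if x == w then #|A| else t x), (fun x => if x == w then v else f x).
split=> [x y|x].
  move=> /setU1P[->|xA] /setU1P[->|yA] //=; rewrite ?eqxx ?neqA //.
  - by have [+ _ _] := tf y yA => /ltn_eqF /[swap] <-; rewrite eqxx.
  - by have [+ _ _] := tf x xA => /ltn_eqF /[swap] ->; rewrite eqxx.
  - exact: t_inj.
rewrite cardsU1 wA add1n => /setU1P[->|xA]; rewrite ?eqxx ?neqA //.
  split=> // y /nbrv[->|yA]; first by rewrite setU11; split; [|left].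
  split; [exact: setU1r|right].
  by rewrite neqA //; case: (tf y yA).
have [ltx efx nbrx] := tf x xA; split=> [//|//|y /nbrx[yA ty]]; first exact: ltnW.
by rewrite neqA //; split; [exact: setU1r|].
Qed.

Section Matching.

Variables (t : V -> nat) (f : V -> V).
Hypotheses (e_sym : symmetric e) (e_f : forall w, e (f w) w).
Hypothesis nbr_f : forall w x, e (f w) x -> x = w \/ (t x < t w)%N.

(** Two distinct vertices with the same forcer would each have to be colored before the other. *)
Lemma forcer_inj : injective f.
Proof.
move=> w w' eqf; have := e_f w; rewrite eqf => /nbr_f[//|lt1].
have := e_f w'; rewrite -eqf => /nbr_f[//|lt2].
by have := ltn_trans lt1 lt2; rewrite ltnn.
Qed.

(** Strong induction on [t z]. By symmetry [f (f z)] is a neighbor of [f z], so it is [z] or is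
    colored earlier; in the latter case the induction hypothesis at [f (f z)] has two outer [f] to
    cancel by injectivity. *)
Lemma forcer_involutive : involutive f.
Proof.
move=> z; have [n] := ubnP (t z); elim: n z => // n IHn z /ltnSE le_tz.
have: e (f z) (f (f z)) by rewrite e_sym e_f.
case/nbr_f=> [//|lt_t].
by apply/forcer_inj/forcer_inj/IHn/(leq_trans lt_t).
Qed.

Hypotheses (e_irr : irreflexive e) (t_inj : injective t).

Lemma matching_orderable : two_set_perfectly_orderable e.
Proof.
pose W := [set w | (t w < t (f w))%N].
pose r := relpre t leq; pose s := sort r (enum W).
have mem_s x : (x \in s) = (t x < t (f x))%N by rewrite mem_sort mem_enum inE.
have uniq_s : uniq s by rewrite sort_uniq enum_uniq.
have sorted_s : sorted r s by apply: sort_sorted => x y; apply: leq_total.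
pose w (i : 'I_(size s)) := tnth (in_tuple s) i.
have wW i : (t (w i) < t (f (w i)))%N by rewrite -mem_s mem_tnth.
have w_onto x : (t x < t (f x))%N -> exists i, x = w i.
  by rewrite -mem_s => /(tnthP (in_tuple s)).
have w_inj : injective w by exact/(tuple_uniqP (in_tuple s)).
have le_w (i j : 'I_(size s)) : (i <= j)%N -> (t (w i) <= t (w j))%N.
  rewrite /w !(tnth_nth (w i)) => le_ij.
  apply: (sorted_leq_nth (leT := r)) => //; rewrite ?inE //.
  - by move=> x y z; apply: leq_trans.
  - by move=> x; apply: leqnn.
have fK := forcer_involutive.
(* A tie would give [f x = x], hence a loop at [x]. *)
have notW x : (t x < t (f x))%N = false -> (t (f x) < t x)%N.
  move=> /negbT; rewrite -leqNgt leq_eqVlt => /orP[/eqP/t_inj fx|//].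
  by have := e_f x; rewrite fx e_irr.
exists (size s), (f \o w), w; split=> [|||i] /=; last exact: e_f.
- by split=> //; apply: inj_comp forcer_inj w_inj.
- split; apply/setP=> x; rewrite !inE.
    apply/negbTE/negP=> /andP[/imsetP[i _ xi] /imsetP[j _ xj]].
    have := wW j; rewrite -xj xi /= fK.
    by move/(ltn_trans (wW i)); rewrite ltnn.
  apply/orP; case xW: (t x < t (f x))%N; [right|left].
    by have [i ->] := w_onto x xW; apply: imset_f.
  have [i fxi] : exists i, f x = w i by apply: w_onto; rewrite fK notW.
  by apply/imsetP; exists i; rewrite //= -fxi fK.
- move=> i v eiv; case: (nbr_f eiv) => [->|lt_vi]; first by exists i.
  have [j vj] : exists j, v = w j.
    apply: w_onto; case vW: (t v < t (f v))%N => //.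
    (* Otherwise v is in U, and f v, colored before v, is colored after f (w i),
       hence after w i. *)
    have: e (f (f v)) (f (w i)) by rewrite fK e_sym.
    case/nbr_f=> [/forcer_inj vi|lt_iv]; first by rewrite vi ltnn in lt_vi.
    have := ltn_trans (wW i) (ltn_trans lt_iv (ltn_trans (notW v vW) lt_vi)).
    by rewrite ltnn.
  exists j; split=> //; rewrite leqNgt; apply/negP=> /ltnW/le_w.
  by rewrite -vj leqNgt lt_vi.
Qed.

End Matching.

Lemma forcing_set0_orderable (e_sym : symmetric e) (e_irr : irreflexive e) :
  skew_zero_forcing_set e set0 -> two_set_perfectly_orderable e.
Proof.
case/forcing_order=> t [f [t_inj tf]].
apply: (@matching_orderable t f) => // [w|w x|x y].
- by have [] := tf w (in_setT w).
- by have [_ _ nbr] := tf w (in_setT w) => /nbr[].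
- exact: t_inj.
Qed.

(** Comparing constant coefficients gives exactly one forcing set of size 0, which must be empty. *)
Lemma skew_zero_forcing_poly_set0 :
  skew_zero_forcing_poly e = ('X + 1) ^+ #|V| -> skew_zero_forcing_set e set0.
Proof.
have coef0 (a : nat -> nat) n :
    (\sum_(i < n.+1) (a i)%:R *: 'X^i : {poly int})`_0 = (a 0%N)%:R.
  by rewrite -(poly_def _ (fun i => (a i)%:R)) coef_poly.
rewrite -sum_bin_XD1 => /(congr1 (fun p : {poly int} => p`_0)).
rewrite [LHS]coef0 [RHS](coef0 (fun i => 'C(_, i))) bin0.
move/eqP; rewrite Num.Theory.eqr_nat => /eqP count0.
have /card_gt0P[S] : (0 < skew_zero_forcing_count e 0)%N by rewrite count0.
by rewrite inE cards_eq0 => /andP[+ /eqP S0]; rewrite S0.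
Qed.

Lemma skew_zero_forcing_poly_all :
  (forall S, skew_zero_forcing_set e S) ->
  skew_zero_forcing_poly e = ('X + 1) ^+ #|V|.
Proof.
move=> forcing; rewrite -sum_bin_XD1; apply: eq_bigr => i _.
rewrite -card_draws /skew_zero_forcing_count; congr (_%:R *: _).
by apply: eq_card => S; rewrite !inE forcing.
Qed.

End SkewForcing.

Theorem corollary10 (V : finType) (e : rel V)
    (e_sym : symmetric e) (e_irr : irreflexive e) :
  \sum_(i < #|V|.+1) 'C(#|V|, i)%:R *: 'X^i = ('X + 1) ^+ #|V| :> {poly int}
  /\ (skew_zero_forcing_poly e = ('X + 1) ^+ #|V|
      <-> two_set_perfectly_orderable e).
Proof.
split; first exact: sum_bin_XD1.
(* One direction uses only the constant coefficient; the other recovers all coefficients, since an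
   order makes every set forcing. *)
split=> [/skew_zero_forcing_poly_set0|ord].
  exact: forcing_set0_orderable.
by apply: skew_zero_forcing_poly_all => S; apply: orderable_forcing.
Qed.
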